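(* Let $D=\{z\in\mathbb{C}:|z-1/2|\le1/2\}$ and let $U\subset\mathbb{R}^2=\mathbb{C}$ be a bounded, mildly regular open set with $\operatorname{int}(D)\subset U$, $x>0$ for all $(x,y)\in U$, $\bar U\supset D$, and $0\le x\le1$, $|y|\le1/2$ for all $(x,y)\in\bar U$. Let $\mathcal{B}=I_1:=\{m+n\mathrm{i}:m\in\mathbb{N},n\in\mathbb{Z}\}$ or $\mathcal{B}=I_2:=\{m+n\mathrm{i}:m\in\mathbb{N},n\in\mathbb{Z},n<0\}$, $\theta_b(z)=1/(z+b)$, let $s>1$ and $R>2$, and let $v_s$ be the (unique up to scalar multiples) strictly positive continuous eigenfunction on $\bar U$ of $L_s$, $(L_sf)(z)=\sum_{b\in\mathcal{B}}|z+b|^{-2s}f(\theta_b(z))$. Then for all $z\in\bar U$: $$\sum_{b\in I_1,|b|>R}\frac{v_s(\theta_b(z))}{|z+b|^{2s}}\le\exp\Big(\frac{s}{\sqrt{R^2-R}}\Big)\Big(\frac{R}{R-1}\Big)^s\Big[\frac{1}{2s-1}\Big(\frac{1}{R-1}\Big)^{2s-1}+\frac{\pi}{2}\cdot\frac{1}{s-1}\Big(\frac{1}{R-\sqrt2}\Big)^{2s-2}\Big]v_s(0)$$ when $\mathcal{B}=I_1$, and $$\sum_{b\in I_2,|b|>R}\frac{v_s(\theta_b(z))}{|z+b|^{2s}}\le\exp\Big(\frac{s}{\sqrt{R^2-R}}\Big)\Big(\frac{R}{R-1}\Big)^s\Big[\frac{\pi}{4}\cdot\frac{1}{s-1}\Big(\frac{1}{R-\sqrt2}\Big)^{2s-2}\Big]v_s(0)$$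 when $\mathcal{B}=I_2$.
   Context: A bounded open set $H\subset\mathbb{R}^n$ is mildly regular if there exist $\eta>0$ and $M\ge1$ such that whenever $x,y\in H$ and $\|x-y\|<\eta$, there is a Lipschitz map $\psi:[0,1]\to H$ with $\psi(0)=x$, $\psi(1)=y$ and $\int_0^1\|\psi'(t)\|\,dt\le M\|x-y\|$. $L_s$ acts on continuous functions on $\bar U$; $\mathbb{N}=\{1,2,\dots\}$. *)

(* Defs.v *)
(* The complex plane C is modelled as R * R
   (z = (x, y) <-> x + i y), with the product topology (= Euclidean topology). *)
From HB Require Import structures.
From mathcomp Require Import all_boot all_order all_algebra.
From mathcomp Require Import all_classical all_reals all_analysis.
Set Implicit Arguments. Unset Strict Implicit. Unset Printing Implicit Defensive.
Import Order.TTheory GRing.Theory Num.Theory.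
Import numFieldNormedType.Exports.
Local Open Scope classical_set_scope.
Local Open Scope ring_scope.

Section Defs.
Variable R : realType.

Definition sqn (p : R * R) : R := p.1 ^+ 2 + p.2 ^+ 2.
Definition enorm (p : R * R) : R := Num.sqrt (sqn p).
Definition edist (p q : R * R) : R := enorm (p.1 - q.1, p.2 - q.2).

Definition ebounded (H : set (R * R)) : Prop :=
  exists C : R, forall p, H p -> enorm p <= C.

(* mildly regular (for the Euclidean norm on R^2); the derivative of the
   Lipschitz curve psi is psi^`() (it exists a.e. on [0,1]). *)
Definition mildly_regular (H : set (R * R)) : Prop :=
  exists eta M : R, 0 < eta /\ 1 <= M /\
  forall x y, H x -> H y -> edist x y < eta ->
  exists psi : R -> R * R,
    (forall t, `[0%R, 1%R]%classic t -> H (psi t)) /\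
    psi 0 = x /\ psi 1 = y /\
    (exists K : R, forall t1 t2, `[0%R, 1%R]%classic t1 -> `[0%R, 1%R]%classic t2 ->
        edist (psi t1) (psi t2) <= K * `|t1 - t2|) /\
    (\int[@lebesgue_measure R]_(t in `[0%R, 1%R]) (enorm (derive1 psi t))%:E
       <= (M * edist x y)%:E)%E.

Definition Dset : set (R * R) :=
  [set p | (p.1 - 2^-1) ^+ 2 + p.2 ^+ 2 <= (2^-1) ^+ 2].

Definition bpt (p : nat * int) : R * R := ((p.1)%:R, (p.2)%:~R).
Definition zadd (z w : R * R) : R * R := (z.1 + w.1, z.2 + w.2).
(* theta_b(z) = 1 / (z + b) *)
Definition theta (b z : R * R) : R * R :=
  let w := zadd z b in (w.1 / sqn w, - w.2 / sqn w).

Definition I1 : set (nat * int) := [set p | (0 < p.1)%N].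
Definition I2 : set (nat * int) := [set p | (0 < p.1)%N /\ p.2 < 0].

(* term |z + b|^(-2s) f(theta_b z) = (|z+b|^2)^(-s) f(theta_b z) *)
Definition Lterm (s : R) (f : R * R -> R) (z : R * R) (p : nat * int) : R :=
  powR (sqn (zadd z (bpt p))) (- s) * f (theta (bpt p) z).

Definition Lop (B : set (nat * int)) (s : R) (f : R * R -> R) (z : R * R)
  : \bar R := (\esum_(p in B) (Lterm s f z p)%:E)%E.

Definition pos_eigfun (U : set (R * R)) (B : set (nat * int)) (s : R)
  (v : R * R -> R) : Prop :=
  {within closure U, continuous v} /\
  (forall z, closure U z -> 0 < v z) /\
  exists lam : R, forall z, closure U z -> Lop B s v z = (lam * v z)%:E.

Definition tailsum (B : set (nat * int)) (Rr s : R) (v : R * R -> R)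
  (z : R * R) : \bar R :=
  (\esum_(p in [set p | B p /\ (Rr < enorm (bpt p))%R]) (Lterm s v z p)%:E)%E.

End Defs.

(* Main.v *)
(* The eigenfunction v is compared with the functions z |-> |z + g|^(-2s), Re g >= 1,
   which generate a cone invariant under L_s.  If c^s bounds the ratio of the
   values at z1 and z2 of all these functions, then v z1 <= c^s v z2: up to a
   factor k > 1 this holds for z1, z2 close to each other because v is uniformly
   continuous, and applying the eigenvalue equation transfers it from the pairs
   (theta_b z1, theta_b z2), which are closer, to (z1, z2).  Hence
   v z <= exp (s |Im z|) v 0.  Since |z + b|^2 >= |b|^2 - |b| >= |b|^2 (R - 1) / R,
   the tail of L_s v is bounded by a multiple of the sum of |b|^(-2s).  The row
   Im b = 0 is compared with the integral of x^(-2s); each open quadrant, unit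
   square by unit square, with the integral of |w|^(-2s) over a quarter plane minus
   a disc of radius R - sqrt 2, which is computed in the coordinates (x, y / x). *)
Require Import Defs.
From HB Require Import structures.
From mathcomp Require Import all_boot all_order all_algebra.
From mathcomp Require Import all_classical all_reals all_analysis.
From mathcomp Require Import measurable_realfun ring lra.
Import Order.TTheory GRing.Theory Num.Theory.
Import numFieldNormedType.Exports.
Local Open Scope classical_set_scope.
Local Open Scope ring_scope.

Set Implicit Arguments.
Unset Strict Implicit.
Unset Printing Implicit Defensive.

(** * Comparison of the values of a positive eigenfunction *)

Section Complex.
Variable R : realType.
Implicit Types (z w g b : R * R) (c d : R).

Definition cinv w : R * R := (w.1 / sqn w, - w.2 / sqn w).

Definition csub z w : R * R := (z.1 - w.1, z.2 - w.2).

Lemma sqn_gt0 w : 0 < w.1 -> 0 < sqn w.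
Proof. by move=> w0; rewrite ltr_wpDr ?sqr_ge0// exprn_gt0. Qed.

Lemma sqn_theta b z : 0 < z.1 + b.1 -> sqn (theta b z) = (sqn (zadd z b))^-1.
Proof.
move=> h; have : sqn (zadd z b) != 0 by rewrite gt_eqF// sqn_gt0.
rewrite /theta /sqn /= => ?; by field.
Qed.

(** With [w = z + b], [1/4 - |1/w - 1/2|^2 = (Re w - 1) / |w|^2], so inversion sends the half plane
    [Re w >= 1] into the disc. *)
Lemma Dset_theta b z : 0 <= z.1 -> 1 <= b.1 -> Dset (theta b z).
Proof.
move=> z0 b1; rewrite /Dset /theta /mkset.
have w1 : 1 <= (zadd z b).1 by rewrite /=; lra.
have w0 : 0 < sqn (zadd z b) by rewrite sqn_gt0//; lra.
move: (zadd z b) w1 w0 => w w1 w0.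
rewrite /= -subr_ge0 [X in 0 <= X](_ : _ = (w.1 - 1) / sqn w).
  by rewrite divr_ge0 ?(ltW w0)//; lra.
have := lt0r_neq0 w0; rewrite /sqn => ?; by field.
Qed.

(** With [w = z + b], [1/w + g = g (w + 1/g) / w]. This is the cone invariance: composing with
    [theta b] replaces the parameter [g] by [b + 1/g], up to the factor [|z + b|]. *)
Lemma sqn_zadd_theta b z g : 0 < z.1 + b.1 -> 0 < g.1 ->
  sqn (zadd (theta b z) g) =
  sqn g * sqn (zadd z (zadd b (cinv g))) / sqn (zadd z b).
Proof.
move=> zb g0; have := lt0r_neq0 (sqn_gt0 g0).
have : sqn (zadd z b) != 0 by rewrite gt_eqF// sqn_gt0.
rewrite /theta /cinv /sqn /= => ? ?; field; exact/andP.
Qed.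

(* [c^s] bounds the ratio of the values at [z1] and [z2] of every
   [z |-> |z + g|^-2s] with [Re g >= 1]. *)
Definition dominates c z1 z2 :=
  forall g, 1 <= g.1 -> sqn (zadd z2 g) <= c * sqn (zadd z1 g).

(** In [sqn_zadd_theta] the factor [|g|^2] is common to both points, and [b + 1/g] again has real
    part at least 1, so the hypothesis applies to it. The ratio left over is the one that the
    weights of [L_s] absorb. *)
Lemma dominates_theta c b z1 z2 : 1 <= b.1 -> 0 <= z1.1 -> 0 <= z2.1 ->
  dominates c z1 z2 ->
  dominates (c * (sqn (zadd z1 b) / sqn (zadd z2 b))) (theta b z1) (theta b z2).
Proof.
move=> b1 z10 z20 cz g g1.
rewrite !sqn_zadd_theta; try lra.
have g0 : 0 < sqn g by rewrite sqn_gt0//; lra.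
have w1 : 0 < sqn (zadd z1 b) by rewrite sqn_gt0//=; lra.
have w2 : 0 < sqn (zadd z2 b) by rewrite sqn_gt0//=; lra.
have /cz : 1 <= (zadd b (cinv g)).1.
  by rewrite /= ler_wpDr// divr_ge0 ?(ltW g0)//; lra.
set S1 := sqn (zadd z1 (zadd _ _)); set S2 := sqn (zadd z2 (zadd _ _)) => h.
rewrite [leRHS](_ : _ = sqn g * (c * S1) / sqn (zadd z2 b)).
  by rewrite ler_pM2r ?invr_gt0// ler_pM2l.
field; by rewrite !lt0r_neq0.
Qed.

(* Let [g] tend to infinity along the real axis. *)
Lemma dominates_ge1 c z1 z2 : 0 <= z1.1 <= 1 -> `|z1.2| <= 1 -> 0 <= z2.1 ->
  dominates c z1 z2 -> 1 <= c.
Proof.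
move=> /andP[x0 x1] y1 x20 cz; rewrite leNgt; apply/negP => c1.
(* Chosen so that [(1 - c) * t = 10 - c]; then [t ^+ 2 <= c * (t + 2) ^+ 2] is impossible for
   [0 < c < 1]. *)
pose t := 1 + 9 / (1 - c).
have t1 : 1 <= t by rewrite lerDl divr_ge0//; lra.
have /= h := cz (t, 0) t1.
have t2 : (1 - c) * t = 1 - c + 9 by rewrite /t; field; lra.
have y2 : z1.2 ^+ 2 <= 1.
  by rewrite -real_normK ?num_real// expr_le1// normr_ge0.
have c0 : 0 < c.
  rewrite ltNge; apply/negP => c0.
  have : 0 < sqn (zadd z2 (t, 0)) by rewrite sqn_gt0//=; lra.
  rewrite ltNge => /negP; apply; rewrite (le_trans h)//.
  by rewrite mulr_le0_ge0// addr_ge0 ?sqr_ge0.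
have h1 : t ^+ 2 <= sqn (zadd z2 (t, 0)).
  rewrite /sqn/= addr0; have := sqr_ge0 z2.2; nra.
have h2 : sqn (zadd z1 (t, 0)) <= (t + 2) ^+ 2.
  rewrite /sqn/= addr0; nra.
have : t ^+ 2 <= c * (t + 2) ^+ 2.
  by rewrite (le_trans h1)// (le_trans h)// ler_pM2l.
nra.
Qed.

Lemma sqn_csub_theta b z1 z2 : 0 < z1.1 + b.1 -> 0 < z2.1 + b.1 ->
  sqn (csub (theta b z1) (theta b z2)) =
  sqn (csub z1 z2) / (sqn (zadd z1 b) * sqn (zadd z2 b)).
Proof.
move=> h1 h2.
have : sqn (zadd z1 b) != 0 by rewrite gt_eqF// sqn_gt0.
have : sqn (zadd z2 b) != 0 by rewrite gt_eqF// sqn_gt0.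
rewrite /theta /csub /sqn /= => ? ?; field; exact/andP.
Qed.

(* [theta b] alone need not contract the Euclidean metric ([b = 1] has
   derivative of modulus 1 at 0), but it contracts this weighted distance. *)
Definition wdist_le d z1 z2 :=
  sqn (csub z1 z2) <= d * ((1 + z1.1) * (1 + z2.1)).

(** With [S = |z + b|^2], [1 + Re (theta b z) = (S + Re (z + b)) / S]. The denominators cancel those
    of [sqn_csub_theta], and [key] gains a factor 2 at each of the two points. *)
Lemma wdist_theta d b z1 z2 : 0 <= d -> 1 <= b.1 -> 0 <= z1.1 -> 0 <= z2.1 ->
  wdist_le (4 * d) z1 z2 -> wdist_le d (theta b z1) (theta b z2).
Proof.
move=> d0 b1 z10 z20; rewrite /wdist_le sqn_csub_theta; try lra.
have w1 : 0 < sqn (zadd z1 b) by rewrite sqn_gt0//=; lra.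
have w2 : 0 < sqn (zadd z2 b) by rewrite sqn_gt0//=; lra.
have key z : 0 <= z.1 -> 2 * (1 + z.1) <= sqn (zadd z b) + (z.1 + b.1).
  by move=> z0; rewrite /sqn/=; have := sqr_ge0 (z.2 + b.2); nra.
move=> h; rewrite ler_pdivrMr ?mulr_gt0//.
rewrite [leRHS](_ : _ = d * ((sqn (zadd z1 b) + (z1.1 + b.1)) *
    (sqn (zadd z2 b) + (z2.1 + b.1)))); last first.
  rewrite /=; field; by rewrite !lt0r_neq0.
rewrite (le_trans h)// -mulrA mulrCA ler_wpM2l//.
rewrite [leLHS](_ : _ = (2 * (1 + z1.1)) * (2 * (1 + z2.1))); last by ring.
by rewrite ler_pM ?key//; lra.
Qed.

Lemma expR_ge_quadratic (t : R) : 0 <= t -> 1 + t + t ^+ 2 / 2 <= expR t.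
Proof.
move=> x0; rewrite /expR.
apply: le_trans (nondecreasing_cvgn_le _ (is_cvg_series_exp_coeff t) 3%N).
  rewrite /series/= !big_nat_recr//= big_geq// /exp_coeff/=.
  by rewrite expr0 expr1 !divr1 add0r.
by apply/nondecreasing_series => n _ _; exact: exp_coeff_ge0.
Qed.

(** Put [t = |Im z|]. Completing the square in [u = Im (z + g)] shows that the constant [1 + e]
    works as soon as [t^2 (1 + e) <= e^2]. The square [E] of the quadratic Taylor polynomial of
    [exp (t / 2)] satisfies this and stays below [exp t]. *)
Lemma dominates_expR z : 0 <= z.1 -> dominates (expR `|z.2|) z (0, 0).
Proof.
move=> x0 g g1; rewrite /sqn/= !add0r.
set t := `|z.2|; have t0 : 0 <= t by rewrite normr_ge0.
pose E := (1 + t / 2 + t ^+ 2 / 8) ^+ 2.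
have Et : E <= expR t.
  rewrite [t in expR t](_ : t = 2%:R * (t / 2)); last by field.
  have h : 1 + t / 2 + t ^+ 2 / 8 <= expR (t / 2).
    by rewrite (le_trans _ (@expR_ge_quadratic (t / 2) _)) ?divr_ge0//; lra.
  rewrite expRM_natl ler_pXn2r ?nnegrE ?expR_ge0//; have := sqr_ge0 t; lra.
have t2 : t ^+ 2 = z.2 ^+ 2 by rewrite real_normK ?num_real.
apply: (@le_trans _ _ (E * (g.1 ^+ 2 + (z.2 + g.2) ^+ 2))); last first.
  rewrite ler_pM ?addr_ge0 ?sqr_ge0// lerD2r; nra.
(* The positive root of [e^2 = t^2 (1 + e)] is [t^2 / 2 + t sqrt (1 + t^2 / 4)]; [P] is a polynomial
   upper bound of that square root. *)
pose P : R := 1 + t ^+ 2 / 8.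
have hE : 1 + t ^+ 2 / 2 + t * P <= E.
  by rewrite /E /P; have := exprn_ge0 4 t0; nra.
have P2 : 1 + t ^+ 2 / 4 <= P ^+ 2 by rewrite /P; have := exprn_ge0 4 t0; nra.
pose e := E - 1.
have he : t ^+ 2 / 2 + t * P <= e by rewrite /e; lra.
set u := z.2 + g.2.
have e0 : 0 <= e.
  rewrite (le_trans _ he)// addr_ge0 ?mulr_ge0 ?divr_ge0// /P.
  by have := sqr_ge0 t; nra.
rewrite -subr_ge0 [X in 0 <= X](_ : _ =
    e * (g.1 ^+ 2 + u ^+ 2) + 2 * u * z.2 - z.2 ^+ 2); last first.
  by rewrite /e /u; ring.
have [y0|y0] := eqVneq z.2 0.
  by rewrite y0; have := sqr_ge0 u; have := sqr_ge0 g.1; nra.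
have {}t0 : 0 < t by rewrite normr_gt0.
have {}e0 : 0 < e.
  rewrite (lt_le_trans _ he)// ltr_wpDr ?divr_gt0 ?exprn_gt0//.
  by rewrite mulr_ge0 ?(ltW t0)// /P; have := sqr_ge0 t; lra.
have ee : t ^+ 2 <= e * (e - t ^+ 2).
  apply: (@le_trans _ _ ((t * P) ^+ 2 - (t ^+ 2 / 2) ^+ 2)).
    rewrite exprMn; have := sqr_ge0 t; nra.
  rewrite [leLHS](_ : _ =
      (t ^+ 2 / 2 + t * P) * (t ^+ 2 / 2 + t * P - t ^+ 2)); last by field.
  have tP : t ^+ 2 / 2 <= t * P by rewrite /P; have := sqr_ge0 (t - 2); nra.
  by rewrite ler_pM ?lerD2r// -?lerBrDr; have := sqr_ge0 t; lra.
have g2 : 1 <= g.1 ^+ 2 by rewrite expr_ge1//; lra.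
(* completing the square in [u] after multiplication by [e] *)
rewrite -(pmulr_rge0 _ e0).
have h : e * e * (1 + u ^+ 2) <= e * e * (g.1 ^+ 2 + u ^+ 2).
  by rewrite ler_pM2l ?mulr_gt0// lerD2r.
have := sqr_ge0 (e * u + z.2); rewrite -t2 => h2.
rewrite (le_trans h2)//; nra.
Qed.

End Complex.

(** * Transfer of the domination to the eigenfunction *)

Section Eigenfunction.
Variable R : realType.
Implicit Types (z w g b : R * R) (c d k s : R).
Implicit Types (U : set (R * R)) (v : R * R -> R).

(** Heine-Cantor, from the near-covering form of compactness, phrased with the squared Euclidean
    distance that [wdist_le] controls. *)
Lemma continuous_compact_uniform (K : set (R * R)) (f : R * R -> R) :
  compact K -> {within K, continuous f} ->
  forall e, 0 < e -> exists2 d, 0 < d & forall z1 z2, K z1 -> K z2 ->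
    sqn (csub z1 z2) <= d -> `|f z1 - f z2| < e.
Proof.
move=> cK /subspace_continuousP cf e e0.
have /near_covering_withinP ncK : near_covering K by apply/compact_near_coveringP.
pose P d z1 := forall z2, K z2 -> sqn (csub z1 z2) <= d -> `|f z1 - f z2| < e.
have : \forall d \near 0^'+, K `<=` P d.
  apply: ncK => x Kx.
  have /cvgrPdist_lt/(_ (e / 2)) := cf x Kx.
  rewrite divr_gt0// => /(_ isT); rewrite near_withinE => /nbhs_ballP[r/= r0 xr].
  have r2 : 0 < r / 2 by rewrite divr_gt0.
  exists (ball x (r / 2), [set d | d < (r / 2) ^+ 2]).
    split; first exact: nbhsx_ballx.
    by apply: nbhs_right_lt; rewrite exprn_gt0.
  move=> [z1 d] /= [xz1 dr] Kz1 z2 Kz2 z12.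
  have xz1' : ball x r z1 by apply: le_ball xz1; lra.
  have h (a : R) : a ^+ 2 <= sqn (csub z1 z2) -> `|a| < r / 2.
    move=> ha; rewrite -(@ltr_pXn2r _ 2) ?nnegrE ?(ltW r2)//.
    by rewrite real_normK ?num_real// (le_lt_trans ha)// (le_lt_trans z12).
  have xz2 : ball x r z2.
    rewrite (splitr r); apply: (ball_triangle xz1); split; apply: h;
      by rewrite /sqn ?lerDl ?lerDr sqr_ge0.
  rewrite (splitr e) -(subrKA (f x)) (le_lt_trans (ler_normD _ _))// ltrD//.
    by rewrite distrC; apply: xr.
  by apply: xr.
rewrite near_withinE => /nbhs_ballP[r/= r0 h].
exists (r / 2); first by rewrite divr_gt0.
move=> z1 z2 Kz1; apply: (h (r / 2)) => //=; last by rewrite divr_gt0.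
by rewrite /ball/= sub0r normrN gtr0_norm ?divr_gt0//; lra.
Qed.

(** Uniform continuity of [ln f], exponentiated. *)
Lemma continuous_compact_ratio (K : set (R * R)) (f : R * R -> R) :
  compact K -> {within K, continuous f} -> (forall z, K z -> 0 < f z) ->
  forall k, 1 < k -> exists2 d, 0 < d & forall z1 z2, K z1 -> K z2 ->
    sqn (csub z1 z2) <= d -> f z1 <= k * f z2.
Proof.
move=> cK /subspace_continuousP cf f0 k k1.
have cl : {within K, continuous (fun z => ln (f z))}.
  apply/subspace_continuousP => z Kz.
  by apply: cvg_comp; [exact: cf | exact: continuous_ln (f0 _ Kz)].
have lk : 0 < ln k by rewrite ln_gt0.
have [d d0 h] := continuous_compact_uniform cK cl lk.
exists d => // z1 z2 Kz1 Kz2 /(h _ _ Kz1 Kz2) /ltW/ler_normlW.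
rewrite lerBlDr -(ler_expR (ln _)) expRD !lnK ?posrE ?f0//; lra.
Qed.

Lemma esum_ler_mul (T : choiceType) (I : set T) (a b : T -> R) c :
  0 <= c -> (forall i, I i -> 0 <= b i) -> (forall i, I i -> a i <= c * b i) ->
  (\esum_(i in I) (a i)%:E <= c%:E * \esum_(i in I) (b i)%:E)%E.
Proof.
move=> c0 b0 ab; apply: ge_ereal_sup => _ [X [finX XI] <-].
apply: (@le_trans _ _ (\sum_(i \in X) (c%:E * (b i)%:E))%E).
  by apply: lee_fsum => // i /XI Ii; rewrite -EFinM lee_fin ab.
apply: (@le_trans _ _ (c%:E * \sum_(i \in X) (b i)%:E)%E).
  by rewrite !fsbig_finite//= !sumEFin -EFinM mulr_sumr.
by apply: lee_wpmul2l; rewrite ?lee_fin//; apply: ereal_sup_ubound; exists X.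
Qed.

Lemma sqn_zadd_bpt_gt0 z (p : nat * int) : 0 <= z.1 -> (0 < p.1)%N ->
  0 < sqn (zadd z (bpt R p)).
Proof. by move=> z0 p0; rewrite sqn_gt0//= ltr_wpDl// ltr0n. Qed.

Lemma Lterm_ge0 s v z (p : nat * int) : 0 <= v (theta (bpt R p) z) ->
  0 <= Lterm s v z p.
Proof. by move=> h; rewrite mulr_ge0// powR_ge0. Qed.

(** A single term of [L_s v] is already positive. Positivity is what allows [lam] to be cancelled
    from inequalities later. *)
Lemma eigenvalue_gt0 U (B : set (nat * int)) s v lam z :
  (forall p, B p -> (0 < p.1)%N) -> B !=set0 ->
  (forall p, closure U p -> 0 <= p.1 <= 1 /\ `|p.2| <= 2^-1) ->
  @Dset R `<=` closure U ->
  (forall w, closure U w -> 0 < v w) -> closure U z ->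
  Lop B s v z = (lam * v z)%:E -> 0 < lam.
Proof.
move=> B1 [p Bp] Ub DU v0 Uz.
have [z0 _] := Ub _ Uz; move: z0 => /andP[z0 _].
have b1 q : B q -> 1 <= (bpt R q).1 by move=> /B1; rewrite /bpt/= ler1n.
have Dt q : B q -> closure U (theta (bpt R q) z).
  by move=> Bq; apply: DU; apply: Dset_theta => //; exact: b1.
move=> e; rewrite -(pmulr_lgt0 _ (v0 _ Uz)) -lte_fin -e.
apply: (@lt_le_trans _ _ (Lterm s v z p)%:E).
  rewrite lte_fin mulr_gt0 ?v0 ?powR_gt0 ?sqn_zadd_bpt_gt0 ?B1//.
  exact: Dt.
apply: esum_ge; exists [set p]; first by split => // q ->.
by rewrite fsbig_set1.
Qed.

(** The ratio [(|z1 + b| / |z2 + b|)^(2s)] lost in passing to [theta b] turns the weight at [z1]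
    into the weight at [z2]. *)
Lemma Lterm_dominates s v z1 z2 c k (p : nat * int) : 0 <= z1.1 -> 0 <= z2.1 ->
  (0 < p.1)%N -> 0 < s -> 0 <= c ->
  v (theta (bpt R p) z1) <=
    k * powR (c * (sqn (zadd z1 (bpt R p)) / sqn (zadd z2 (bpt R p)))) s *
      v (theta (bpt R p) z2) ->
  Lterm s v z1 p <= k * powR c s * Lterm s v z2 p.
Proof.
move=> z10 z20 p0 s0 c0; rewrite /Lterm.
have w1 := sqn_zadd_bpt_gt0 z10 p0; have w2 := sqn_zadd_bpt_gt0 z20 p0.
move: (sqn _) w1 (sqn _) w2 => S1 w1 S2 w2.
rewrite !powRM ?divr_ge0 ?(ltW w1) ?invr_ge0 ?(ltW w2)// => h.
rewrite -powR_inv1 ?(ltW w2)// -powRrM mulN1r in h.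
have := ler_wpM2l (powR_ge0 S1 (- s)) h => /le_trans; apply.
rewrite [in leLHS]powRN le_eqVlt; apply/orP; left; apply/eqP.
by have := lt0r_neq0 (powR_gt0 s w1) => ?; field.
Qed.

Definition near_dominated U s v k d := forall z1 z2 c, closure U z1 ->
  closure U z2 -> wdist_le d z1 z2 -> dominates c z1 z2 ->
  v z1 <= k * powR c s * v z2.

(** Both values are rewritten as sums by the eigenvalue equation. The pairs
    [(theta_b z1, theta_b z2)] lie in the disc at weighted distance at most [d], so the hypothesis
    applies term by term; [k] is unchanged. *)
Lemma near_dominated4 U (B : set (nat * int)) s v k d :
  (forall p, B p -> (0 < p.1)%N) -> B !=set0 ->
  (forall p, closure U p -> 0 <= p.1 <= 1 /\ `|p.2| <= 2^-1) ->
  @Dset R `<=` closure U -> 0 < s -> 0 < k -> 0 <= d ->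
  pos_eigfun U B s v ->
  near_dominated U s v k d -> near_dominated U s v k (4 * d).
Proof.
move=> B1 B0 Ub DU s0 k0 d0 [_ [v0 [lam vlam]]] vd z1 z2 c Uz1 Uz2 z12 cz.
have [/andP[z10 z11] y1] := Ub _ Uz1; have [/andP[z20 z21] _] := Ub _ Uz2.
have c1 : 1 <= c.
  apply: dominates_ge1 cz => //; first by rewrite z10.
  by lra.
have lam0 := eigenvalue_gt0 B1 B0 Ub DU v0 Uz1 (vlam _ Uz1).
have Ut z q : 0 <= z.1 -> B q -> closure U (theta (bpt R q) z).
  by move=> ? Bq; apply: DU; apply: Dset_theta => //; rewrite ler1n B1.
rewrite -(ler_pM2l lam0) mulrCA -lee_fin -vlam// EFinM -vlam//.
apply: esum_ler_mul => [|q Bq|q Bq].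
- by rewrite mulr_ge0 ?powR_ge0// ltW.
- by apply: Lterm_ge0; rewrite ltW// v0//; exact: Ut.
- have b1 : 1 <= (bpt R q).1 by rewrite ler1n B1.
  apply: Lterm_dominates => //; [exact: B1|lra|].
  by apply: vd; [exact: Ut|exact: Ut|exact: wdist_theta|exact: dominates_theta].
Qed.

(** Uniform continuity starts an induction in which the admissible distance grows fourfold at fixed
    [k], until it covers every pair in [closure U]. *)
Lemma eigfun_dominates U (B : set (nat * int)) s v z1 z2 c :
  (forall p, B p -> (0 < p.1)%N) -> B !=set0 ->
  (forall p, closure U p -> 0 <= p.1 <= 1 /\ `|p.2| <= 2^-1) ->
  @Dset R `<=` closure U -> 0 < s ->
  pos_eigfun U B s v -> closure U z1 -> closure U z2 -> dominates c z1 z2 ->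
  v z1 <= powR c s * v z2.
Proof.
move=> B1 B0 Ub DU s0 vP Uz1 Uz2 cz.
have [vc [v0 _]] := vP.
have cU : compact (closure U).
  apply: (subclosed_compact (@closed_closure _ U)
    (compact_setX (@segment_compact R 0 1) (@segment_compact R (-1) 1))).
  by move=> p /Ub[p1]; rewrite ler_norml => p2; split; rewrite /= in_itv/=; lra.
(* Passage to the limit [k -> 1]. *)
suff all_k k : 1 < k -> v z1 <= k * (powR c s * v z2).
  set X := powR c s * v z2 in all_k *.
  have X0 : 0 <= X by rewrite mulr_ge0 ?powR_ge0 ?ltW ?v0.
  apply/ler_addgt0Pr => e e0.
  have X1 : 0 < X + 1 by lra.
  apply: (le_trans (all_k (1 + e / (X + 1)) _)); first by rewrite ltrDl divr_gt0.
  rewrite mulrDl mul1r lerD2l mulrAC ler_pdivrMr// ler_pM2l//; lra.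
move=> k1.
have [d d0 hd] := continuous_compact_ratio cU vc v0 k1.
(* The start is [d / 4] because the weight [(1 + z1.1) * (1 + z2.1)] is at most 4 on [closure U];
   the factor [c'^s >= 1] only helps. *)
have nd n : near_dominated U s v k (4 ^+ n * (d / 4)).
  elim: n => [|n IH]; last first.
    rewrite exprS -mulrA; apply: (near_dominated4 B1 B0 Ub DU s0) vP IH; first lra.
    by rewrite mulr_ge0 ?exprn_ge0//; lra.
  rewrite mul1r => w1 w2 c' Uw1 Uw2 w12 cw.
  have [/andP[x0 x1] y1] := Ub _ Uw1; have [/andP[x20 x21] _] := Ub _ Uw2.
  have c1 : 1 <= c'.
    by apply: dominates_ge1 cw => //; [rewrite x0|lra].
  have cs1 : 1 <= powR c' s by rewrite -(powRr0 c') ler_powR// ltW.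
  apply: (@le_trans _ _ (k * v w2)).
    apply: hd => //; rewrite (le_trans w12)// mulrAC ler_pdivrMr// ler_pM2l//.
    nra.
  rewrite ler_pM2r ?v0// ler_peMr//; lra.
(* 2 bounds the squared Euclidean diameter of [[0,1] x [-1/2,1/2]], and the weight is at least 1. *)
have [n hn] : exists n, 2 <= 4 ^+ n * (d / 4).
  exists (Num.bound (8 / d)).
  have /archi_boundP : 0 <= 8 / d by rewrite divr_ge0 ?ltW.
  set n := Num.bound _; rewrite ltr_pdivrMr// => hn.
  have : n%:R <= 4 ^+ n :> R by rewrite -natrX ler_nat ltnW// ltn_expl.
  nra.
rewrite mulrA; apply: (nd n) => //; rewrite /wdist_le.
have [/andP[x0 x1]] := Ub _ Uz1; have [/andP[x20 x21]] := Ub _ Uz2.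
rewrite !ler_norml => /andP[? ?] /andP[? ?].
apply: (@le_trans _ _ 2); first by rewrite /sqn/=; nra.
rewrite (le_trans hn)// ler_peMr//; nra.
Qed.

Lemma eigfun_le_expR U (B : set (nat * int)) s v z :
  (forall p, B p -> (0 < p.1)%N) -> B !=set0 ->
  (forall p, closure U p -> 0 <= p.1 <= 1 /\ `|p.2| <= 2^-1) ->
  @Dset R `<=` closure U -> 0 < s ->
  pos_eigfun U B s v -> closure U z -> v z <= expR (s * `|z.2|) * v (0, 0).
Proof.
move=> B1 B0 Ub DU s0 vP Uz; rewrite [s * _]mulrC expRM.
apply: (eigfun_dominates B1 B0 Ub DU s0 vP Uz).
  by apply: DU; rewrite /Dset/=; lra.
by apply: dominates_expR; have [/andP[]] := Ub _ Uz.
Qed.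

End Eigenfunction.

(** * Sums over the lattice *)

Section LatticeSums.
Variable R : realType.
Implicit Types (a p q rho s t x y : R).
Notation mu := (@lebesgue_measure R).

Lemma powRN_cvgy q : 0 < q -> powR x (- q) @[x --> +oo] --> 0.
Proof.
move=> q0; apply/cvgrPdist_lt => e e0; near=> x.
have x0 : 0 < x by near: x; exact: nbhs_pinfty_gt.
have hx : powR e^-1 q^-1 < x by near: x; apply: nbhs_pinfty_gt; rewrite num_real.
rewrite sub0r normrN ger0_norm ?powR_ge0// powRN invf_plt ?posrE ?powR_gt0//.
have := gt0_ltr_powR q0 _ _ hx.
rewrite -powRrM mulVf ?gt_eqF// powRr1 ?invr_ge0 ?ltW//; apply.
  by rewrite nnegrE powR_ge0.
by rewrite nnegrE ltW.
Unshelve. all: by end_near. Qed.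

Lemma powR_inv a p : 0 <= a -> powR a^-1 p = powR a (- p).
Proof. by move=> a0; rewrite -(powR_inv1 a0) -powRrM mulN1r. Qed.

Lemma integral_powRN a p : 0 < a -> 1 < p ->
  (\int[mu]_(x in `[a, +oo[) (powR x (- p))%:E =
   ((p - 1)^-1 * powR a (1 - p))%:E)%E.
Proof.
move=> a0 p1; have p0 : p - 1 != 0 by rewrite subr_eq0 gt_eqF.
pose F x := - (p - 1)^-1 * powR x (1 - p).
have dF x : 0 < x -> is_derive x 1 F (powR x (- p)).
  move=> x0; rewrite [powR x (- p)](_ : _ =
      (- (p - 1)^-1) *: ((1 - p) * powR x (1 - p - 1))).
    by apply: is_deriveZ; exact: is_derive1_powR.
  have -> : 1 - p - 1 = - p by ring.
  by rewrite /GRing.scale/=; field.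
have cF x : 0 < x -> {for x, continuous F}.
  move=> x0; apply: differentiable_continuous; apply/derivable1_diffP.
  by case: (dF x x0).
rewrite (@ge0_continuous_FTC2y _ _ F a 0).
- by rewrite sub0e -EFinN /F mulNr opprK.
- by move=> x _; exact: powR_ge0.
- apply: continuous_in_subspaceT => x; rewrite inE/= in_itv/= andbT => ax.
  have x0 : 0 < x by rewrite (lt_le_trans a0).
  apply: differentiable_continuous; apply/derivable1_diffP.
  by case: (is_derive1_powR (- p) x0).
- rewrite -[X in _ --> X](mulr0 (- (p - 1)^-1)); apply: cvgM; first exact: cvg_cst.
  by rewrite -(opprB p 1); apply: powRN_cvgy; rewrite subr_gt0.
- by move=> x ax; case: (dF x (lt_trans a0 ax)).
- by apply: cvg_at_right_filter; exact: cF.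
- move=> x; rewrite in_itv/= andbT => ax; rewrite derive1E.
  by case: (dF x (lt_trans a0 ax)).
Qed.

(** Comparison on the disjoint unit cells []n, n + 1]]. Values are extended reals so that the lemma
    can be iterated for a double sum. *)
Lemma esum_le_integral (al : nat -> \bar R) (phi : R -> \bar R) :
  measurable_fun [set: measurableTypeR R] phi -> (forall x, 0 <= phi x)%E ->
  (forall n, 0 <= al n)%E ->
  (forall n x, (n%:R < x)%R -> (x <= n.+1%:R)%R -> al n <= phi x)%E ->
  (\esum_(n in [set: nat]) al n <= \int[mu]_x phi x)%E.
Proof.
move=> mphi phi0 al0 alphi; rewrite -nneseries_esumT//.
pose I n : set R := `]n%:R, n.+1%:R]%classic.
have mI n : measurable (I n) by exact: measurable_itv.
have tI : trivIset setT I.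
  move=> i j _ _ [x []]; rewrite /I/= !in_itv/= => /andP[ix xi] /andP[jx xj].
  have ij : i%:R < j.+1%:R :> R by rewrite (lt_le_trans ix).
  have ji : j%:R < i.+1%:R :> R by rewrite (lt_le_trans jx).
  by rewrite !ltr_nat !ltnS in ij ji; apply/eqP; rewrite eqn_leq ij ji.
apply: (@le_trans _ _ (\int[mu]_(x in \bigcup_n I n) phi x)%E); last first.
  apply: ge0_subset_integral => //.
  by apply: bigcup_measurable => n _; exact: mI.
rewrite ge0_integral_bigcup//; last exact: measurable_funS mphi.
apply: lee_nneseries => // n _.
apply: (@le_trans _ _ (\int[mu]_(x in I n) cst (al n) x)%E).
  have muI : mu (I n) = 1%E.
    rewrite /I lebesgue_measure_itv/= lte_fin ltr_nat ltnSn.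
    by rewrite -EFinD -natr1 addrAC subrr add0r.
  have := integral_cst mu (mI n) (al n).
  by rewrite [X in (_ * X)%E](muI : _ = _) mule1 => ->.
apply: ge0_le_integral; first exact: mI.
- by move=> x _; exact: al0.
- exact: measurable_cst.
- exact: (measurable_funTS mphi).
by move=> x; rewrite /I/= in_itv/= => /andP[]; exact: alphi.
Qed.

(** If [a + 1 < n + 1], the cell to the left of [n + 1] lies in [[a, +oo[], and there the integrand
    [x^(-2s)] is at least its value at [n + 1]. *)
Lemma esum_row_le a s : 0 < a -> 1 < 2 * s ->
  (\esum_(n in [set: nat])
     (if a + 1 < n.+1%:R then powR (n.+1%:R ^+ 2) (- s) else 0)%:E <=
   ((2 * s - 1)^-1 * powR a (1 - 2 * s))%:E)%E.
Proof.
move=> a0 s1; rewrite -integral_powRN// integral_mkcond.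
apply: esum_le_integral.
- apply/(measurable_restrictT _ _).1 => //.
  by apply/measurable_EFinP; apply: measurable_funTS; exact: measurable_powR.
- by move=> x; apply: erestrict_ge0 => y _; rewrite lee_fin powR_ge0.
- by move=> n; rewrite lee_fin; case: ifP => // _; exact: powR_ge0.
move=> n x nx xn; rewrite patchE.
case: ifPn => [an|_]; last first.
  by case: ifP => // _; rewrite lee_fin powR_ge0.
have ax : a <= x by move: an; rewrite -natr1; lra.
rewrite mem_set/= ?in_itv/= ?ax// lee_fin.
rewrite -powR_mulrn ?ler0n// -powRrM mulrN !powRN.
rewrite lef_pV2 ?posrE ?powR_gt0//; last by lra.
by rewrite ge0_ler_powR ?nnegrE//; lra.
Qed.

(** * Integral of [|w|^(-2s)] over a quarter plane outside a disc *)

Notation planeT := [set: measurableTypeR R * measurableTypeR R].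

Definition quarter_fun rho s (w : R * R) : \bar R :=
  (if [&& 0 < w.1, 0 <= w.2 & rho ^+ 2 <= sqn w]
   then powR (sqn w) (- s) else 0)%:E.

(* The integrand of [quarter_fun] after the substitution [w.2 = w.1 * t]; here
   [w.2] stands for the slope [t]. *)
Definition quarter_fun_slope rho s (w : R * R) : \bar R :=
  (if [&& 0 < w.1, 0 <= w.2 & rho ^+ 2 <= w.1 ^+ 2 * (1 + w.2 ^+ 2)]
   then w.1 * powR (w.1 ^+ 2 * (1 + w.2 ^+ 2)) (- s) else 0)%:E.

Lemma quarter_fun_ge0 rho s w : (0 <= quarter_fun rho s w)%E.
Proof. by rewrite lee_fin; case: ifP => // _; exact: powR_ge0. Qed.

Lemma quarter_fun_slope_ge0 rho s w : (0 <= quarter_fun_slope rho s w)%E.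
Proof.
rewrite lee_fin; case: ifP => // /and3P[w0 _ _].
by rewrite mulr_ge0 ?powR_ge0 ?ltW.
Qed.

Lemma measurable_quarter_fun rho s :
  measurable_fun planeT (quarter_fun rho s).
Proof.
have m1 : measurable_fun planeT (fun w => w.1 : R) by exact: measurable_fst.
have m2 : measurable_fun planeT (fun w => w.2 : R) by exact: measurable_snd.
have mn : measurable_fun planeT (fun w => sqn w : R).
  by apply: measurable_funD; exact: measurable_funX.
apply/measurable_EFinP; apply: measurable_fun_ifT => //.
  apply: measurable_and; first exact: measurable_fun_ltr.
  by apply: measurable_and; exact: measurable_fun_ler.
exact: (measurableT_comp (measurable_powR (- s)) mn).
Qed.

Lemma measurable_quarter_fun_slope rho s :
  measurable_fun planeT (quarter_fun_slope rho s).
Proof.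
have m1 : measurable_fun planeT (fun w => w.1 : R) by exact: measurable_fst.
have m2 : measurable_fun planeT (fun w => w.2 : R) by exact: measurable_snd.
have mn : measurable_fun planeT (fun w => w.1 ^+ 2 * (1 + w.2 ^+ 2) : R).
  apply: measurable_funM; first exact: measurable_funX.
  by apply: measurable_funD => //; exact: measurable_funX.
apply/measurable_EFinP; apply: measurable_fun_ifT => //.
  apply: measurable_and; first exact: measurable_fun_ltr.
  by apply: measurable_and; exact: measurable_fun_ler.
apply: measurable_funM => //.
exact: (measurableT_comp (measurable_powR (- s)) mn).
Qed.

(** On a fixed vertical line this is the substitution [y = t * x], whose Jacobian is [x]. *)
Lemma integral_quarter_fun_slice rho s x : 0 < rho ->
  (\int[mu]_y quarter_fun rho s (x, y) =
   \int[mu]_t quarter_fun_slope rho s (x, t))%E.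
Proof.
move=> rho0.
have [x0|x0] := leP x 0.
  by apply: eq_integral => y _; rewrite /quarter_fun /quarter_fun_slope/= ltNge x0.
(* [Num.sqrt] is 0 on negative numbers, so the slice is [[Y, +oo[] also when [x > rho]. *)
pose Y := Num.sqrt (rho ^+ 2 - x ^+ 2).
have Y0 : 0 <= Y by exact: sqrtr_ge0.
have YP y : 0 <= y -> (rho ^+ 2 <= x ^+ 2 + y ^+ 2) = (Y <= y).
  by move=> y0; rewrite -lerBlDl -[y in RHS]ger0_norm// -sqrtr_sqr ler_sqrt ?sqr_ge0.
pose G y := powR (x ^+ 2 + y ^+ 2) (- s).
pose F t := t * x.
have cG y : {for y, continuous G}.
  apply: (@continuous_comp _ _ _ (fun y => x ^+ 2 + y ^+ 2) (fun z => powR z (- s))).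
    by apply: continuousD; [exact: cst_continuous|exact: exprn_continuous].
  have w0 : 0 < x ^+ 2 + y ^+ 2 by rewrite ltr_pwDl ?exprn_gt0 ?sqr_ge0.
  apply: differentiable_continuous; apply/derivable1_diffP.
  by case: (is_derive1_powR (- s) w0).
have dF t : is_derive t 1 F x.
  rewrite (_ : F = fun t => x *: (t : R^o)); last first.
    by apply/funext => u; rewrite /GRing.scale/= mulrC.
  by apply: is_derive_eq; rewrite /GRing.scale/= mulr1.
have cF : continuous F.
  move=> t; apply: differentiable_continuous; apply/derivable1_diffP.
  by case: (dF t).
have FD : derive1 F = cst x.
  by apply/funext => t; rewrite derive1E; case: (dF t).
transitivity (\int[mu]_(y in `[Y, +oo[) (G y)%:E)%E.
  rewrite [RHS]integral_mkcond; apply: eq_integral => y _.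
  rewrite patchE mem_setE in_itv/= andbT /quarter_fun /sqn /= x0/=.
  have [y0|y0] := leP 0 y; first by rewrite YP//=; case: ifP.
  by rewrite [Y <= y]leNgt (lt_le_trans y0 Y0).
have FY : F (Y / x) = Y by rewrite /F mulfVK ?gt_eqF.
rewrite -{1}FY.
rewrite (@increasing_ge0_integration_by_substitutiony _ F G (Y / x)).
- rewrite integral_mkcond; apply: eq_integral => t _.
  rewrite patchE mem_setE in_itv/= andbT ler_pdivrMr// /quarter_fun_slope/= x0/= FD.
  have [t0|t0] := leP 0 t; last first.
    by rewrite [Y <= _]leNgt (lt_le_trans _ Y0)// nmulr_rlt0.
  rewrite -YP ?mulr_ge0 ?(ltW x0)//.
  have -> : x ^+ 2 * (1 + t ^+ 2) = x ^+ 2 + (t * x) ^+ 2 by ring.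
  by case: ifP => // _; rewrite /F /G/= mulrC.
- by move=> a b _ _ ab; rewrite /F ltr_pM2r.
- by rewrite FD => t _; exact: cst_continuous.
- by rewrite FD; exact: is_cvg_cst.
- by rewrite FD; exact: is_cvg_cst.
- by split => [t _|]; [case: (dF t)|apply: cvg_at_right_filter; exact: cF].
- apply/cvgryPge => A; near=> t.
  by rewrite -ler_pdivrMr//; near: t; apply: nbhs_pinfty_ge; rewrite num_real.
- by apply: continuous_in_subspaceT => y _; exact: cG.
- by move=> y _; exact: powR_ge0.
Unshelve. all: by end_near. Qed.

(** With [k = 1 + t^2] the slice is [x >= a = rho k^(-1/2)] and the integrand [k^(-s) x^(1-2s)]. The
    powers of [k] combine to [k^(-1)], the derivative of arctan. *)
Lemma integral_quarter_fun_slope_slice rho s t : 0 < rho -> 1 < s ->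
  (\int[mu]_x quarter_fun_slope rho s (x, t) <=
   ((2 * s - 2)^-1 * powR rho (2 - 2 * s))%:E *
   (((fun t => (oneDsqr t)^-1%:E) \_ `[0%R, +oo[) t))%E.
Proof.
move=> rho0 s1; rewrite patchE mem_setE in_itv/= andbT.
have [t0|t0] := leP 0 t; last first.
  rewrite integral0_eq ?mule0// => x _.
  by rewrite /quarter_fun_slope/= leNgt t0 andbF.
pose k := oneDsqr t; have k0 : 0 < k by rewrite /k /oneDsqr ltr_pwDl ?sqr_ge0.
pose a := rho * powR k (- 2^-1).
have kk : powR k (- 2^-1) ^+ 2 = k^-1.
  by rewrite -powR_mulrn ?powR_ge0// -powRrM mulNr mulVf// powR_inv1// ltW.
have a0 : 0 < a by rewrite mulr_gt0 ?powR_gt0.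
have aP x : 0 < x -> (rho ^+ 2 <= x ^+ 2 * k) = (a <= x).
  move=> x0; rewrite -ler_pdivrMr// -kk -exprMn.
  by rewrite ler_pXn2r ?nnegrE ?(ltW a0) ?(ltW x0).
rewrite [leLHS](_ : _ = (powR k (- s))%:E *
    \int[mu]_(x in `[a, +oo[) (powR x (- (2 * s - 1)))%:E)%E.
  rewrite integral_powRN//; last by lra.
  rewrite -!EFinM lee_fin -/k.
  have -> : 1 - (2 * s - 1) = 2 - 2 * s by ring.
  have -> : 2 * s - 1 - 1 = 2 * s - 2 by ring.
  rewrite /a powRM ?powR_ge0 ?(ltW rho0)// -powRrM.
  have -> : k^-1 = powR k (- s) * powR k (- 2^-1 * (2 - 2 * s)).
    rewrite -powRD; last by rewrite (gt_eqF k0) implybT.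
    by rewrite -(powR_inv1 (ltW k0)); congr (powR _ _); field.
  by rewrite le_eqVlt; apply/orP; left; apply/eqP; ring.
rewrite -ge0_integralZl_EFin ?powR_ge0//; last 2 first.
- by move=> x _; rewrite lee_fin powR_ge0.
- by apply/measurable_EFinP; apply: measurable_funTS; exact: measurable_powR.
rewrite [RHS]integral_mkcond; apply: eq_integral => x _.
rewrite patchE mem_setE in_itv/= andbT /quarter_fun_slope/= t0/= -/k.
have [x0|x0] := ltP 0 x; last by rewrite [a <= x]leNgt (le_lt_trans x0 a0).
have -> : 1 + t ^+ 2 = k by [].
rewrite aP//=; case: ifP => // _; rewrite -EFinM; apply: congr1.
rewrite powRM ?sqr_ge0 ?(ltW k0)// -powR_mulrn ?(ltW x0)// -powRrM.
rewrite -[X in X * (_ * _)](powRr1 (ltW x0)) mulrA -powRD; last first.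
  by rewrite (gt_eqF x0) implybT.
by rewrite mulrC; congr (_ * powR _ _); ring.
Qed.

(** Tonelli puts the slope outside; its integral over [[0, +oo[] is [pi / 2], and division by
    [2 * s - 2] gives the constant. *)
Lemma integral_quarter_fun rho s : 0 < rho -> 1 < s ->
  (\int[mu]_x \int[mu]_y quarter_fun rho s (x, y) <=
   (pi / 4 * (s - 1)^-1 * powR rho (2 - 2 * s))%:E)%E.
Proof.
move=> rho0 s1.
have -> : (\int[mu]_x \int[mu]_y quarter_fun rho s (x, y) =
    \int[mu]_x \int[mu]_t quarter_fun_slope rho s (x, t))%E.
  by apply: eq_integral => x _; exact: integral_quarter_fun_slice.
rewrite (@fubini_tonelli _ _ _ _ _ mu mu (quarter_fun_slope rho s)); last 2 first.
- exact: measurable_quarter_fun_slope.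
- by move=> w; exact: quarter_fun_slope_ge0.
have mo : measurable_fun [set: measurableTypeR R]
    ((fun t => (@oneDsqr R t)^-1%:E) \_ `[0%R, +oo[).
  apply/(measurable_restrictT _ _).1 => //.
  apply/measurable_EFinP; apply: measurable_funTS.
  by apply: continuous_measurable_fun; exact: continuous_oneDsqrV.
have o0 t : (0 <= ((fun t => (@oneDsqr R t)^-1%:E) \_ `[0%R, +oo[) t)%E.
  by apply: erestrict_ge0 => u _; rewrite lee_fin invr_ge0 addr_ge0 ?sqr_ge0.
have c0 : 0 <= (2 * s - 2)^-1 * powR rho (2 - 2 * s).
  by rewrite mulr_ge0 ?powR_ge0// invr_ge0; lra.
apply: (@le_trans _ _ (\int[mu]_t
  (((2 * s - 2)^-1 * powR rho (2 - 2 * s))%:E *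
   (((fun t => (oneDsqr t)^-1%:E) \_ `[0%R, +oo[) t)))%E).
  apply: ge0_le_integral => //.
  - by move=> t _; apply: integral_ge0 => x _; exact: quarter_fun_slope_ge0.
  - apply: measurable_fun_fubini_tonelli_G.
    + exact: measurable_quarter_fun_slope.
    + by move=> w; exact: quarter_fun_slope_ge0.
  - exact: measurable_funeM.
  - by move=> t _; exact: integral_quarter_fun_slope_slice.
rewrite ge0_integralZl_EFin// -integral_mkcond integral0y_oneDsqr -EFinM lee_fin.
rewrite le_eqVlt; apply/orP; left; apply/eqP; field; lra.
Qed.

(** The corner [(m + 1, n + 1)] is within [sqrt 2] of every point of its cell, so the cell avoids
    the disc of radius [rho]; the corner is also the point of the cell of largest modulus. *)
Lemma powR_le_quarter_fun rho s (m n : nat) x y : 0 < rho -> 0 < s ->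
  m%:R < x -> x <= m.+1%:R -> n%:R < y -> y <= n.+1%:R ->
  ((if (rho + Num.sqrt 2) ^+ 2 < sqn (m.+1%:R, n.+1%:R)
    then powR (sqn (m.+1%:R, n.+1%:R)) (- s) else 0)%:E <=
   quarter_fun rho s (x, y))%E.
Proof.
move=> rho0 s0 mx xm ny yn; case: ifPn => [h|_]; last exact: quarter_fun_ge0.
have m0 : 0 <= m%:R :> R by []; have n0 : 0 <= n%:R :> R by [].
have x0 : 0 < x by lra.
have y0 : 0 < y by lra.
rewrite /quarter_fun /= x0 (ltW y0)/=.
have w0 : 0 < sqn (x, y) by exact: sqn_gt0.
have -> : rho ^+ 2 <= sqn (x, y).
  rewrite leNgt; apply/negP => hw; move: h; apply/negP; rewrite -leNgt.
  pose w := Num.sqrt (sqn (x, y)).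
  have w2 : w ^+ 2 = sqn (x, y) by rewrite sqr_sqrtr// ltW.
  have q2 : Num.sqrt 2 ^+ 2 = 2 :> R by rewrite sqr_sqrtr.
  have q0 : 0 <= Num.sqrt 2 :> R by exact: sqrtr_ge0.
  have ww0 : 0 <= w by exact: sqrtr_ge0.
  apply: (@le_trans _ _ ((w + Num.sqrt 2) ^+ 2)); last first.
    rewrite ler_pXn2r ?nnegrE ?addr_ge0 ?(ltW rho0)// lerD2r.
    by rewrite -(@ler_pXn2r _ 2) ?nnegrE ?(ltW rho0)// w2 ltW.
  (* Cauchy-Schwarz; it yields [(x + 1)^2 + (y + 1)^2 <= (w + sqrt 2)^2]. *)
  have xy : x + y <= Num.sqrt 2 * w.
    rewrite -(@ler_pXn2r _ 2) ?nnegrE ?mulr_ge0 ?addr_ge0 ?(ltW x0) ?(ltW y0)//.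
    by rewrite exprMn q2 w2 /sqn/=; have := sqr_ge0 (x - y); nra.
  have hm : m.+1%:R ^+ 2 <= (x + 1) ^+ 2 :> R.
    by rewrite lerXn2r ?nnegrE -?natr1//; lra.
  have hn : n.+1%:R ^+ 2 <= (y + 1) ^+ 2 :> R.
    by rewrite lerXn2r ?nnegrE -?natr1//; lra.
  by rewrite sqrrD w2 q2 /sqn/=; rewrite !sqrrD in hm hn; lra.
rewrite lee_fin !powRN lef_pV2 ?posrE ?powR_gt0 ?sqn_gt0//=.
apply: ge0_ler_powR; [exact: ltW|by rewrite nnegrE ltW| |].
  by rewrite nnegrE ltW// sqn_gt0.
by rewrite /sqn/= lerD// lerXn2r ?nnegrE ?ler0n ?(ltW x0) ?(ltW y0).
Qed.

Lemma esum_quarter_le rho s : 0 < rho -> 1 < s ->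
  (\esum_(p in [set: nat * nat])
     (if (rho + Num.sqrt 2) ^+ 2 < sqn (p.1.+1%:R, p.2.+1%:R)
      then powR (sqn (p.1.+1%:R, p.2.+1%:R)) (- s) else 0)%:E <=
   (pi / 4 * (s - 1)^-1 * powR rho (2 - 2 * s))%:E)%E.
Proof.
move=> rho0 s1; apply: le_trans (integral_quarter_fun rho0 s1).
set al := fun p : nat * nat => _.
have al0 (p : nat * nat) : (0 <= al p)%E.
  by rewrite lee_fin; case: ifP => // _; exact: powR_ge0.
rewrite (_ : [set: nat * nat] = [set: nat] `*`` fun=> [set: nat]); last first.
  by apply/seteqP; split.
rewrite -(esum_esum (a := fun m n => al (m, n)))//.
have mq x : measurable_fun [set: measurableTypeR R]
    (fun y => quarter_fun rho s (x, y)).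
  by apply: (measurableT_comp (measurable_quarter_fun rho s)).
apply: esum_le_integral.
- by apply: measurable_fun_fubini_tonelli_F;
    [exact: measurable_quarter_fun|move=> w; exact: quarter_fun_ge0].
- by move=> x; apply: integral_ge0 => y _; exact: quarter_fun_ge0.
- by move=> m; exact: esum_ge0.
move=> m x mx xm; apply: esum_le_integral => //.
- by move=> y; exact: quarter_fun_ge0.
by move=> n y ny yn; apply: powR_le_quarter_fun => //; lra.
Qed.

End LatticeSums.

(** * The tail of the transfer operator *)

Section Tail.
Variable R : realType.
Implicit Types (z w : R * R) (p : nat * int) (s Rr : R).
Implicit Types (U : set (R * R)) (v : R * R -> R).

Lemma sqr_lt_sqn (a : R) (w : R * R) : 0 <= a -> (a ^+ 2 < sqn w) = (a < enorm w).
Proof.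
move=> a0; rewrite -[RHS](@ltr_pXn2r _ 2) ?nnegrE ?sqrtr_ge0//.
by rewrite /enorm sqr_sqrtr// addr_ge0 ?sqr_ge0.
Qed.

(** The cross term of the real parts is nonnegative, and that of the imaginary parts is at least
    [-|b.2| >= -|b|]. *)
Lemma sqn_zadd_ge z b : 0 <= z.1 -> `|z.2| <= 2^-1 -> 0 <= b.1 ->
  enorm b ^+ 2 - enorm b <= sqn (zadd z b).
Proof.
move=> z1 z2 b1.
have b2 : `|b.2| <= enorm b.
  rewrite -(@ler_pXn2r _ 2) ?nnegrE ?sqrtr_ge0// real_normK ?num_real//.
  by rewrite /enorm sqr_sqrtr ?lerDr ?addr_ge0 ?sqr_ge0.
rewrite {1}/enorm sqr_sqrtr ?addr_ge0 ?sqr_ge0// /sqn/=.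
move: z2 b2; rewrite !ler_norml => /andP[? ?] /andP[? ?].
have := sqr_ge0 z.2; nra.
Qed.

(** The value of [v] and the weight are estimated separately; both rest on
    [|z + b|^2 >= |b|^2 - |b|]. *)
Lemma Lterm_tail_le U B s Rr v z p :
  (forall p, B p -> (0 < p.1)%N) -> B !=set0 ->
  (forall w, closure U w -> 0 <= w.1 <= 1 /\ `|w.2| <= 2^-1) ->
  @Dset R `<=` closure U -> 0 < s -> 1 < Rr ->
  pos_eigfun U B s v -> closure U z -> B p -> Rr < enorm (bpt R p) ->
  Lterm s v z p <=
    expR (s / Num.sqrt (Rr ^+ 2 - Rr)) * powR (Rr / (Rr - 1)) s * v (0, 0) *
    powR (sqn (bpt R p)) (- s).
Proof.
move=> B1 B0 Ub DU s0 R1 vP Uz Bp Rb.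
have [/andP[z10 z11] z2] := Ub _ Uz.
have b1 : 1 <= (bpt R p).1 by rewrite ler1n B1.
have S0 := sqn_zadd_bpt_gt0 z10 (B1 _ Bp).
have e0 : 0 < enorm (bpt R p) by lra.
have e2 : enorm (bpt R p) ^+ 2 = sqn (bpt R p).
  by rewrite /enorm sqr_sqrtr// addr_ge0 ?sqr_ge0.
have Se : enorm (bpt R p) ^+ 2 - enorm (bpt R p) <= sqn (zadd z (bpt R p)).
  by apply: sqn_zadd_ge => //; lra.
have SR : Rr ^+ 2 - Rr <= sqn (zadd z (bpt R p)) by rewrite (le_trans _ Se)//; nra.
have R20 : 0 < Rr ^+ 2 - Rr by nra.
have Sb : sqn (bpt R p) * (Rr / (Rr - 1))^-1 <= sqn (zadd z (bpt R p)).
  rewrite (le_trans _ Se)// -e2 invf_div mulrA ler_pdivrMr; last by lra.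
  nra.
have DT : Dset (theta (bpt R p) z) by exact: Dset_theta.
have v00 : 0 < v (0, 0).
  by have [_ [v0 _]] := vP; apply: v0; apply: DU; rewrite /Dset/=; lra.
(* [|Im (theta_b z)| <= |theta_b z| = 1 / |z + b| <= 1 / sqrt (Rr^2 - Rr)]. *)
have vth : v (theta (bpt R p) z) <= expR (s / Num.sqrt (Rr ^+ 2 - Rr)) * v (0, 0).
  apply: (le_trans (eigfun_le_expR B1 B0 Ub DU s0 vP (DU _ DT))).
  rewrite ler_pM2r// ler_expR ler_pM2l//.
  have th0 : 0 <= sqn (theta (bpt R p) z) by rewrite addr_ge0 ?sqr_ge0.
  have thS : sqn (theta (bpt R p) z) = (sqn (zadd z (bpt R p)))^-1.
    by apply: sqn_theta; lra.
  apply: (@le_trans _ _ (Num.sqrt (sqn (theta (bpt R p) z)))).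
    by rewrite -sqrtr_sqr ler_sqrt// lerDr sqr_ge0.
  rewrite thS -sqrtrV ?(ltW R20)// ler_sqrt ?invr_ge0 ?(ltW R20)//.
  by rewrite lef_pV2 ?posrE.
have b0 : 0 < sqn (bpt R p) by apply: sqn_gt0; lra.
have q0 : 0 < Rr / (Rr - 1) by rewrite divr_gt0; lra.
have SS : powR (sqn (zadd z (bpt R p))) (- s) <=
    powR (sqn (bpt R p)) (- s) * powR (Rr / (Rr - 1)) s.
  rewrite -[s in powR (_ / _) s]opprK -(powR_inv (- s) (ltW q0)).
  rewrite -powRM ?(ltW b0) ?invr_ge0 ?(ltW q0)// !powRN.
  rewrite lef_pV2 ?posrE ?powR_gt0 ?mulr_gt0 ?invr_gt0//.
  rewrite ge0_ler_powR ?nnegrE ?(ltW s0) ?(ltW S0)//.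
  by rewrite mulr_ge0 ?invr_ge0 ?(ltW b0) ?(ltW q0).
rewrite /Lterm.
rewrite [leRHS](_ : _ = (powR (sqn (bpt R p)) (- s) * powR (Rr / (Rr - 1)) s) *
  (expR (s / Num.sqrt (Rr ^+ 2 - Rr)) * v (0, 0))); last by ring.
apply: ler_pM => //; first exact: powR_ge0.
by have [_ [v0 _]] := vP; rewrite ltW// v0//; exact: DU.
Qed.

(** The cutoff sits in the summand, so that the index set can be split by the sign of the imaginary
    part. *)
Definition tail_weight s Rr p : R :=
  if Rr < enorm (bpt R p) then powR (sqn (bpt R p)) (- s) else 0.

Lemma tail_weight_ge0 s Rr p : 0 <= tail_weight s Rr p.
Proof. by rewrite /tail_weight; case: ifP => // _; exact: powR_ge0. Qed.

Lemma tailsum_le U B s Rr v z :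
  (forall p, B p -> (0 < p.1)%N) -> B !=set0 ->
  (forall w, closure U w -> 0 <= w.1 <= 1 /\ `|w.2| <= 2^-1) ->
  @Dset R `<=` closure U -> 0 < s -> 1 < Rr ->
  pos_eigfun U B s v -> closure U z ->
  (tailsum B Rr s v z <=
    (expR (s / Num.sqrt (Rr ^+ 2 - Rr)) * powR (Rr / (Rr - 1)) s * v (0, 0))%:E *
    \esum_(p in B) (tail_weight s Rr p)%:E)%E.
Proof.
move=> B1 B0 Ub DU s0 R1 vP Uz; rewrite /tailsum.
rewrite (_ : [set p | _] = B `&` [set p | Rr < enorm (bpt R p)]); last first.
  by apply/seteqP; split.
rewrite esum_mkcondr.
have v00 : 0 < v (0, 0).
  by have [_ [v0 _]] := vP; apply: v0; apply: DU; rewrite /Dset/=; lra.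
rewrite (_ : \esum_(i in B) _ = \esum_(i in B)
    (if Rr < enorm (bpt R i) then Lterm s v z i else 0)%:E)%E; last first.
  apply: eq_esum => p Bp; rewrite (_ : (p \in _) = (Rr < enorm (bpt R p))).
    by case: ifP.
  by apply/idP/idP; rewrite inE.
apply: esum_ler_mul => [|p _|p Bp].
- by rewrite !mulr_ge0 ?expR_ge0 ?powR_ge0 ?ltW.
- exact: tail_weight_ge0.
- rewrite /tail_weight; case: ifPn => [pR|_]; last by rewrite mulr0.
  exact: Lterm_tail_le vP Uz Bp pR.
Qed.

(** [Negz n] is [-(n + 1)], so both coordinates start at modulus 1, as in [esum_quarter_le]. *)
Lemma set_bij_I2 :
  set_bij [set: nat * nat] I2 (fun m => (m.1.+1, Negz m.2)).
Proof.
split => [[m n] _|[m n] [m' n'] _ _ [-> ->]//|[[|m] [n|n]] []//= _ _].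
  by split.
by exists (m, n).
Qed.

Lemma esum_I2_le s Rr : 1 < s -> 2 < Rr ->
  (\esum_(p in I2) (tail_weight s Rr p)%:E <=
   (pi / 4 * (s - 1)^-1 * powR (Rr - Num.sqrt 2)^-1 (2 * s - 2))%:E)%E.
Proof.
move=> s1 R2.
have q2 : Num.sqrt 2 < 2 :> R.
  by rewrite -(@ltr_pXn2r _ 2) ?nnegrE ?sqrtr_ge0// sqr_sqrtr//; lra.
(* The disc radius is [rho = Rr - sqrt 2], so that the cutoff [rho + sqrt 2] equals [Rr]. *)
have rho0 : 0 < Rr - Num.sqrt 2 by lra.
rewrite (powR_inv _ (ltW rho0)) opprB.
apply: le_trans (esum_quarter_le rho0 s1).
rewrite (reindex_esum _ _ _ _ set_bij_I2).
apply: le_esum => -[m n] _.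
rewrite lee_fin /tail_weight subrK -sqr_lt_sqn; last by lra.
by rewrite /bpt/= NegzE /sqn/= mulrNz sqrrN.
Qed.

(** Split by [Im b < 0], [= 0], [> 0]. Conjugation preserves [|b|], so the last part equals the
    first, and the two quadrants together turn [pi / 4] into [pi / 2]. *)
Lemma esum_I1_le s Rr : 1 < s -> 2 < Rr ->
  (\esum_(p in I1) (tail_weight s Rr p)%:E <=
   ((2 * s - 1)^-1 * powR (Rr - 1)^-1 (2 * s - 1) +
    pi / 2 * (s - 1)^-1 * powR (Rr - Num.sqrt 2)^-1 (2 * s - 2))%:E)%E.
Proof.
move=> s1 R2.
have h2 := esum_I2_le s1 R2.
rewrite (esumID [set p | p.2 < 0]); last first.
  by move=> p _; rewrite lee_fin tail_weight_ge0.
rewrite (_ : I1 `&` _ = I2)//.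
rewrite (esumID [set p | p.2 = 0] (I1 `&` ~` _)); last first.
  by move=> p _; rewrite lee_fin tail_weight_ge0.
set X := powR (_ - Num.sqrt 2)^-1 _ in h2 *.
rewrite [leRHS](_ : _ = ((pi / 4 * (s - 1)^-1 * X)%:E +
  (((2 * s - 1)^-1 * powR (Rr - 1)^-1 (2 * s - 1))%:E +
   (pi / 4 * (s - 1)^-1 * X)%:E))%E); last first.
  by rewrite -!EFinD; congr EFin; field; lra.
apply: leeD => //; apply: leeD.
  have R1 : 0 < Rr - 1 by lra.
  rewrite (powR_inv _ (ltW R1)) opprB.
  have s2 : 1 < 2 * s by lra.
  apply: le_trans (esum_row_le R1 s2).
  rewrite (reindex_esum [set: nat] _ (fun m => (m.+1, 0%:Z))); last first.
    split => [m _|m m' _ _ [->]//|[[|m] n] [[//= _ _] /= ->]].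
      by [].
    by exists m.
  apply: le_esum => m _.
  rewrite lee_fin /tail_weight subrK -sqr_lt_sqn; last by lra.
  rewrite /sqn/= expr0n addr0 ltr_pXn2r ?nnegrE//; lra.
apply: le_trans h2.
rewrite [leRHS](reindex_esum _ _ _ _ set_bij_I2).
rewrite [leLHS](reindex_esum [set: nat * nat] _
    (fun m : nat * nat => (m.1.+1, Posz m.2.+1))); last first.
  split => [[m n] _//|[m n] [m' n'] _ _ [-> ->]//|].
  move=> [[|m] [[|n]|n]] [[/= m0 n0] n1]//; by exists (m, n).
apply: le_esum => -[m n] _; rewrite lee_fin /tail_weight /enorm.
rewrite (_ : sqn (bpt R (m.+1, Negz n)) = sqn (bpt R (m.+1, Posz n.+1)))//.
by rewrite NegzE /sqn/= mulrNz sqrrN.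
Qed.

End Tail.

Unset Implicit Arguments.

Theorem theorem5p12 (R : realType) (U : set (R * R)) (s Rr : R) :
  ebounded U -> open U -> mildly_regular U ->
  interior (@Dset R) `<=` U ->
  (forall p, U p -> 0 < p.1) ->
  @Dset R `<=` closure U ->
  (forall p, closure U p -> 0 <= p.1 <= 1 /\ `|p.2| <= 2^-1) ->
  1 < s -> 2 < Rr ->
  (forall v : R * R -> R, pos_eigfun U I1 s v ->
     forall z, closure U z ->
     (tailsum I1 Rr s v z <=
      (expR (s / Num.sqrt (Rr ^+ 2 - Rr)) * powR (Rr / (Rr - 1)) s *
       ((2 * s - 1)^-1 * powR ((Rr - 1)^-1) (2 * s - 1) +
        pi / 2 * (s - 1)^-1 * powR ((Rr - Num.sqrt 2)^-1) (2 * s - 2)) *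
       v (0, 0))%:E)%E) /\
  (forall v : R * R -> R, pos_eigfun U I2 s v ->
     forall z, closure U z ->
     (tailsum I2 Rr s v z <=
      (expR (s / Num.sqrt (Rr ^+ 2 - Rr)) * powR (Rr / (Rr - 1)) s *
       (pi / 4 * (s - 1)^-1 * powR ((Rr - Num.sqrt 2)^-1) (2 * s - 2)) *
       v (0, 0))%:E)%E).
Proof.
move=> _ _ _ _ _ DU Ub s1 R2.
have s0 : 0 < s by lra.
have R1 : 1 < Rr by lra.
have D0 : closure U (0, 0) by apply: DU; rewrite /Dset/=; lra.
(* Common to both alphabets; only the bound [X] of the lattice sum differs. *)
have finish (B : set (nat * int)) v z X :
    (forall p, B p -> (0 < p.1)%N) -> B !=set0 -> pos_eigfun U B s v ->
    closure U z ->
    (\esum_(p in B) (tail_weight s Rr p)%:E <= X%:E)%E ->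
    (tailsum B Rr s v z <= (expR (s / Num.sqrt (Rr ^+ 2 - Rr)) *
      powR (Rr / (Rr - 1)) s * X * v (0, 0))%:E)%E.
  move=> B1 B0 vP Uz hX; rewrite mulrAC EFinM.
  apply: (le_trans (tailsum_le B1 B0 Ub DU s0 R1 vP Uz)).
  apply: lee_wpmul2l => //; rewrite lee_fin !mulr_ge0 ?expR_ge0 ?powR_ge0//.
  by have [_ [v0 _]] := vP; rewrite ltW// v0.
split=> v vP z Uz; apply: finish => //.
- by exists (1%N, 0).
- exact: esum_I1_le.
- by move=> p [].
- by exists (1%N, -1).
- exact: esum_I2_le.
Qed.
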